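(* Let $p>3$ be a prime and let $\omega_6=(1+i\sqrt{3})/2$ (a root of $x^2-x+1$). Then \begin{align*} \pounds_2(1+\omega_6^{\pm 1})&\equiv -\frac{q_p(3)^2}{16}\left(3\pm i\sqrt{3}\left(\frac{p}{3}\right)\right)+\frac{1}{36}\left(3\left(\frac{p}{3}\right)\mp i\sqrt{3}\right)B_{p-2}(1/3) \pmod{p},\\ \pounds_2\bigl((1+\omega_6^{\pm 1})/3\bigr)&\equiv -\frac{q_p(3)^2}{8}+\frac{1}{36}\left(\left(\frac{p}{3}\right)\pm i\sqrt{3}\right)B_{p-2}(1/3) \pmod{p}. \end{align*}
   Context: For a prime $p$ and a positive integer $d$, the finite polylogarithm is $\pounds_d(x)=\sum_{k=1}^{p-1} x^k/k^d$. $q_p(a)=(a^{p-1}-1)/p$ is the Fermat quotient. $B_n(x)$ denotes the $n$-th Bernoulli polynomial and $\left(\frac{\cdot}{\cdot}\right)$ the Legendre symbol. Congruences modulo $p$ are taken in the ring of elements of $\mathbb{Q}(\sqrt{-3})$ that are integral at all primes above $p$: $a\equiv b\pmod p$ means $(a-b)/p$ is such an element. *)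

(* Defs.v *)
From HB Require Import structures.
From mathcomp Require Import all_boot all_order all_algebra all_field.
From mathcomp Require Import ring_quotient ring.

Set Implicit Arguments.
Unset Strict Implicit.
Unset Printing Implicit Defensive.

Import Order.TTheory GRing.Theory Num.Theory.
Local Open Scope ring_scope.

Definition sqrtm3 : algC := 'i * sqrtC 3.

Definition omega6 : algC := (1 + sqrtm3) / 2.

Definition Qsqrtm3 : {pred algC} := Crat_span [:: 1; sqrtm3].

Definition intQsqrtm3 : {pred algC} :=
  [pred x | (x \in Qsqrtm3) && (x \in Aint)].

Lemma sqrtm3_sqr : sqrtm3 * sqrtm3 = - 3.
Proof. by rewrite /sqrtm3 mulrACA -!expr2 sqrCi sqrtCK mulN1r. Qed.

Lemma Qsqrtm3P x :
  reflect (exists a b : rat, x = ratr a + ratr b * sqrtm3) (x \in Qsqrtm3).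
Proof.
apply: (iffP (Crat_spanP _ _)) => [[a ->]|[a [b ->]]].
  exists (a ord0), (a ord_max); rewrite !big_ord_recl big_ord0 addr0 mulr1.
  by congr (_ + ratr (a _) * _); apply: val_inj.
exists [ffun i => if i == ord0 then a else b].
by rewrite !big_ord_recl big_ord0 !ffunE /= mulr1 addr0.
Qed.

Lemma intQsqrtm3_subring : subring_closed intQsqrtm3.
Proof.
split=> [|x y /andP[Kx Ax] /andP[Ky Ay]|x y /andP[Kx Ax] /andP[Ky Ay]];
  apply/andP; split.
- by rewrite mem_Crat_span ?mem_head.
- exact: Aint1.
- exact: rpredB.
- exact: rpredB.
- case/Qsqrtm3P: Kx => a [b ->]; case/Qsqrtm3P: Ky => c [d ->].
  apply/Qsqrtm3P; exists (a * c - b * d *+ 3), (a * d + b * c).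
  rewrite rmorphB rmorphMn rmorphD /= !rmorphM.
  have := sqrtm3_sqr; move: sqrtm3 => r r2; rewrite -mulr_natr -[- (_ * 3)]mulrN.
  by rewrite -r2; ring.
- exact: rpredM.
Qed.

HB.instance Definition _ :=
  GRing.isSubringClosed.Build algC intQsqrtm3 intQsqrtm3_subring.

Record OQsqrtm3 := MkOQsqrtm3 { OQval : algC; _ : OQval \in intQsqrtm3 }.

HB.instance Definition _ := [isSub for OQval].
HB.instance Definition _ := [Choice of OQsqrtm3 by <:].
HB.instance Definition _ := [SubChoice_isSubComNzRing of OQsqrtm3 by <:].

(* Membership in the localization of the ring of integers at P. *)
Definition integral_at (P : {pred OQsqrtm3}) (x : algC) : Prop :=
  exists a b : OQsqrtm3, b \notin P /\ x = \val a / \val b.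

Definition integral_above (p : nat) (x : algC) : Prop :=
  x \in Qsqrtm3 /\
  forall P : {pred OQsqrtm3},
    idealr_closed P -> prime_idealr_closed P -> p%:R \in P -> integral_at P x.

Definition cong_mod (p : nat) (a b : algC) : Prop :=
  integral_above p ((a - b) / p%:R).

Definition polylog (p d : nat) (x : algC) : algC :=
  \sum_(1 <= k < p) x ^+ k / k%:R ^+ d.

Definition fermat_quotient (p a : nat) : rat := (a%:R ^+ p.-1 - 1) / p%:R.

(* [:: B_0; ...; B_n], with B_1 = -1/2, from
   B_n = [n = 0] - \sum_(k < n) 'C(n, k) * B_k / (n - k + 1). *)
Fixpoint bernoulli_seq (n : nat) : seq rat :=
  if n is m.+1 then
    let s := bernoulli_seq m in
    rcons s (- \sum_(k < m.+1) 'C(m.+1, k)%:R * s`_k / (m.+1 - k).+1%:R)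
  else [:: 1].

Definition bernoulli (n : nat) : rat := (bernoulli_seq n)`_n.

Definition bernoulli_poly (n : nat) : {poly rat} :=
  \sum_(k < n.+1) ('C(n, k)%:R * bernoulli k) *: 'X^(n - k).

(* The Legendre symbol (a / q), for q an odd prime. *)
Definition legendre (a q : nat) : int :=
  if (q %| a)%N then 0
  else if [exists x : 'I_q, x ^ 2 == a %[mod q]] then 1 else -1.

(* Main.v *)
(* Put [z := - omega6 ^ e], a primitive cube root of unity with [1 - z = 1 + omega6 ^ e],
   write [G_d] for the finite polylogarithm, and work in the residue ring of
   [Z_(p)[sqrt (-3)]] modulo [p].  Granville's identity
     [2 x^p G_2(x) + 2 (1 - x^p) G_2(1 - x) + G_1(x)^2 = 0]
   at [x = z] reduces [G_2(1 - z)] to [G_1(z)] and [G_2(z)].  The first is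
   [- (1 - z^p) q_p(3) / 2], by expanding the [p]-th power of [(1 - z)(1 - z^2) = 3]
   modulo [p^2].  For the second, [G_2(1) + G_2(z) + G_2(z^2)] is three times the sum of
   [1/k^2] over the multiples [k < p] of [3], [G_2(1) = 0], and [G_2(1/x) = x^-p G_2(x)];
   that sum is a multiple of [B_(p-2)] at an integer congruent to [1/3] or [2/3] modulo [p].
   The second congruence follows from the first by inversion, as
   [(1 - z) / 3 = 1 / (1 - z^2)]. *)

Require Import Defs.
From HB Require Import structures.
From mathcomp Require Import all_boot all_order all_algebra all_field.
From mathcomp Require Import cyclic ring_quotient ring zify.
From mathcomp Require boolp.

Set Implicit Arguments.
Unset Strict Implicit.
Unset Printing Implicit Defensive.

Import Order.TTheory GRing.Theory Num.Theory.
Local Open Scope ring_scope.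

(** [(n + 2) %/ 3] is the ceiling of [n / 3], the number of multiples of [3] below [n] with [0]
    included. *)
Lemma big_ord_dvd3 (V : nmodType) (F : nat -> V) n :
  \sum_(k < n | (3 %| k)%N) F k = \sum_(j < ((n + 2) %/ 3)) F (3 * j)%N.
Proof.
elim: n => [|n IHn]; first by rewrite !big_ord0.
rewrite big_mkcond big_ord_recr -big_mkcond /= {}IHn.
case: ifP => [/dvdnP[k ->]|n3].
  have -> : ((k * 3 + 2) %/ 3 = k)%N by lia.
  have -> : (((k * 3).+1 + 2) %/ 3 = k.+1)%N by lia.
  by rewrite big_ord_recr /= mulnC.
rewrite addr0; have -> // : ((n.+1 + 2) %/ 3 = (n + 2) %/ 3)%N.
move/negbT: n3; rewrite /dvdn; lia.
Qed.

(** * Finite polylogarithms in characteristic [p] *)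

Section CharP.
Variables (p : nat) (R : comNzRingType).
Hypotheses (p_prime : prime p) (pR : p%:R = 0 :> R).
Let p_gt1 : (1 < p)%N := prime_gt1 p_prime.

Lemma natr_dvd0 n : (p %| n)%N -> n%:R = 0 :> R.
Proof. by case/dvdnP=> k ->; rewrite natrM pR mulr0. Qed.

Lemma dvdn_Fermat k : ~~ (p %| k)%N -> (p %| k ^ p.-1 - 1)%N.
Proof.
move=> pk; have k0 : (0 < k)%N by case: k pk => //; rewrite dvdn0.
rewrite -eqn_mod_dvd ?expn_gt0 ?k0 // -totient_prime //; apply/eqP.
by apply: Euler_exp_totient; rewrite coprime_sym prime_coprime.
Qed.

Lemma natr_Fermat k : ~~ (p %| k)%N -> k%:R ^+ p.-1 = 1 :> R.
Proof.
move=> pk; have k0 : (0 < k)%N by case: k pk => //; rewrite dvdn0.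
move/natr_dvd0: (dvdn_Fermat pk); rewrite natrB ?expn_gt0 ?k0 // natrX.
by move/eqP; rewrite subr_eq0 => /eqP.
Qed.

(** [R] may have zero divisors, so cancelling [k] takes an inverse: by Fermat, [k ^ (p - 2)] is
    one. *)
Lemma natr_mul_eq0 k x : ~~ (p %| k)%N -> k%:R * x = 0 -> x = 0 :> R.
Proof.
move=> pk kx0; rewrite -[x]mul1r -(natr_Fermat pk).
have ->: p.-1 = p.-2.+1 by lia.
by rewrite exprSr -mulrA kx0 mulr0.
Qed.

Lemma natr_lt_mul_eq0 k x : (0 < k < p)%N -> k%:R * x = 0 -> x = 0 :> R.
Proof.
case/andP=> k0 kp; apply: natr_mul_eq0.
by apply/negP => /dvdn_leq; rewrite k0 => /(_ isT); rewrite leqNgt kp.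
Qed.

(** A zero derivative kills every coefficient of index prime to [p]. The size bound leaves the
    indices [0] and [p], and the values at [0] and [1] kill these. *)
Lemma deriv0_poly_eq0 (f : {poly R}) :
  f^`() = 0 -> (size f <= p.*2)%N -> f.[0] = 0 -> f.[1] = 0 -> f = 0.
Proof.
move=> f'0 szf f0 f1.
have cz i : ~~ (p %| i)%N -> f`_i = 0.
  case: i => [|i] pi; first by rewrite dvdn0 in pi.
  have := congr1 (fun g : {poly R} => g`_i) f'0.
  by rewrite coef_deriv coef0 -mulr_natl; apply: natr_mul_eq0.
have c0 : f`_0 = 0 by rewrite -horner_coef0.
have cp : f`_p = 0.
  move: f1; rewrite (horner_coef_wide _ szf).
  have pp : (p < p.*2)%N by lia.
  rewrite (bigD1 (Ordinal pp)) //= big1 ?addr0 ?expr1n ?mulr1 // => -[i ip2] /= ip.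
  rewrite expr1n mulr1; case: (posnP i) => [-> //|i0]; apply: cz.
  apply/negP => /dvdnP[[|[|k]] ik]; rewrite ?mul1n ?mul0n in ik.
  - by rewrite ik in i0.
  - by case/eqP: ip; apply: val_inj.
  - by have := ip2; rewrite ik; nia.
apply/polyP => i; rewrite coef0; case: (boolP (p %| i)%N) => [/dvdnP[[|[|k]] ->]|/cz//].
- by rewrite mul0n.
- by rewrite mul1n.
- by rewrite nth_default // (leq_trans szf) //; nia.
Qed.

Lemma Frobenius_1BX : (1 - 'X) ^+ p = 1 - 'X^p :> {poly R}.
Proof.
have pch : p \in [pchar {poly R}].
  by rewrite inE p_prime -polyC_natr pR /=.
have := pFrobenius_autB_comm pch (commr_sym (commr1 (polyX R))).
by rewrite !pFrobenius_autE expr1n.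
Qed.

Lemma rreg_1BX : GRing.rreg (1 - 'X : {poly R}).
Proof.
move=> f g; rewrite -[1 - 'X]opprB !mulrN => /oppr_inj.
by apply: monic_rreg; rewrite -polyC1 monicXsubC.
Qed.

(** Cancel [1 - X] from [(1 - X) ^ p = 1 - X ^ p], whose right-hand side is [1 - X] times the
    geometric sum. *)
Lemma expr_1BX_pred : (1 - 'X) ^+ p.-1 = \poly_(i < p) 1 :> {poly R}.
Proof.
apply: rreg_1BX; rewrite -exprSr prednK ?prime_gt0 // Frobenius_1BX.
rewrite poly_def (eq_bigr (fun i : 'I_p => 'X^i)) => [|i _]; last by rewrite scale1r.
rewrite -[in LHS](expr1n _ p) subrXX mulrC; congr (_ * _).
by apply: eq_bigr => i _; rewrite expr1n mul1r.
Qed.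

(** Multiplication by a nonzero [g] permutes ['F_p] and multiplies the sum by [g ^ m], so the sum
    vanishes once [g ^ m != 1]. Such a [g] exists, as [X ^ m - 1] has at most [m < p - 1] roots. *)
Lemma dvdn_powersum m : (0 < m < p.-1)%N -> (p %| \sum_(k < p) k ^ m)%N.
Proof.
case/andP=> m0 mp; rewrite (dvdn_pcharf (pchar_Fp p_prime)) natr_sum; apply/eqP.
have [g g0 gm] : exists2 g : 'F_p, g != 0 & g ^+ m != 1.
  suff /existsP[g /andP[g0 gm]] : [exists g : 'F_p, (g != 0) && (g ^+ m != 1)] by exists g.
  apply: contraLR mp; rewrite negb_exists -leqNgt => /forallP H.
  have sz : size ('X^m - 1 : {poly 'F_p}) = m.+1 by rewrite size_XnsubC.
  have nz : 'X^m - 1 != 0 :> {poly 'F_p} by rewrite -size_poly_eq0 sz.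
  have := max_poly_roots nz _ (undup_uniq (enum [pred x : 'F_p | x != 0])).
  rewrite undup_id ?enum_uniq // sz -cardE cardC1 card_Fp //; apply.
  apply/allP => x; rewrite mem_enum inE => x0; rewrite rootE !hornerE.
  by have := H x; rewrite x0 negbK subr_eq0.
have -> : \sum_(k < p) (k ^ m)%:R = \sum_(x : 'F_p) x ^+ m.
  transitivity (\sum_(x : 'F_p) ((x : nat) ^ m)%:R : 'F_p).
    rewrite -(big_mkord predT (fun k => (k ^ m)%:R)) -(big_mkord predT (fun k => (k ^ m)%:R)).
    by rewrite Fp_cast.
  by apply: eq_bigr => x _; rewrite natrX natr_Zp.
set S := \sum_x _; have : S = g ^+ m * S.
  rewrite mulr_sumr /S (reindex_inj (mulfI g0)) /=.
  by apply: eq_bigr => x _; rewrite exprMn.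
move/eqP; rewrite -[X in X == _]mul1r -subr_eq0 -mulrBl mulf_eq0 subr_eq0 eq_sym.
by rewrite (negPf gm) => /eqP.
Qed.

Lemma natr_powersum m : (0 < m < p.-1)%N -> \sum_(k < p) k%:R ^+ m = 0 :> R.
Proof.
move=> mp; rewrite -[RHS](natr_dvd0 (dvdn_powersum mp)) natr_sum.
by apply: eq_bigr => k _; rewrite natrX.
Qed.

(** By Pascal's rule, neighbours in row [p - 1] add up to an inner entry of row [p], which [p]
    divides; hence the signs alternate. *)
Lemma natr_bin_pred j : (j < p)%N -> 'C(p.-1, j)%:R = (-1) ^+ j :> R.
Proof.
elim: j => [|j IHj] jp; first by rewrite bin0.
have pj : (p %| 'C(p, j.+1))%N by apply: prime_dvd_bin; rewrite // jp.
have := natr_dvd0 pj; rewrite -{1}(prednK (prime_gt0 p_prime)) binS natrD IHj ?(ltnW jp) //.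
by move/eqP; rewrite addr_eq0 => /eqP ->; rewrite exprS mulN1r.
Qed.

(** [k * ('C(p, k) / p)] equals ['C(p - 1, k - 1)], which reduces to [(-1) ^ (k - 1)], and
    [k ^ (p - 2)] inverts [k]. *)
Lemma natr_bin_div k : (0 < k < p)%N -> ('C(p, k) %/ p)%:R = - (-1) ^+ k * k%:R ^+ (p - 2) :> R.
Proof.
move=> /andP[k0 kp]; set c := (_ %/ _)%N.
have Ec : ('C(p, k) = c * p)%N by rewrite divnK // prime_dvd_bin // k0.
have kc : (k * c = 'C(p.-1, k.-1))%N.
  apply/eqP; rewrite -(eqn_pmul2l (prime_gt0 p_prime)); apply/eqP.
  by rewrite mul_bin_diag prednK // Ec; lia.
have pk : ~~ (p %| k)%N by apply/negP => /dvdn_leq; lia.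
apply/eqP; rewrite -subr_eq0; apply/eqP; apply: (natr_mul_eq0 pk).
rewrite mulrBr -natrM kc natr_bin_pred; last by lia.
rewrite mulrCA -exprS; have -> : (p - 2).+1 = p.-1 by lia.
rewrite natr_Fermat // mulr1; have {2}-> : k = k.-1.+1 by lia.
by rewrite exprS mulN1r opprK subrr.
Qed.

(* Over [R], where [p] is [0], this is the reduction of the finite polylogarithm:
   [k ^ (p - 1 - d)] is the inverse of [k ^ d]. *)
Definition fpolylog d : {poly R} := \poly_(k < p) k%:R ^+ (p.-1 - d).

Hypothesis p_gt3 : (3 < p)%N.

Lemma prime_dvd3 : (3 %| p)%N = false.
Proof. by rewrite dvdn_prime2 //; apply/eqP => p3; move: p_gt3; rewrite -p3. Qed.

Lemma prime_odd : odd p.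
Proof. by case: (even_prime p_prime) => // p2; move: p_gt3; rewrite p2. Qed.

Lemma size_fpolylog d : (size (fpolylog d) <= p)%N.
Proof. exact: size_poly. Qed.

Lemma coef_fpolylog d i : (fpolylog d)`_i = if (i < p)%N then i%:R ^+ (p.-1 - d) else 0.
Proof. exact: coef_poly. Qed.

Lemma horner_fpolylog d x : (d < p.-1)%N ->
  (fpolylog d).[x] = \sum_(1 <= k < p) k%:R ^+ (p.-1 - d) * x ^+ k.
Proof.
move=> dp; rewrite horner_poly -(big_mkord predT (fun k => k%:R ^+ (p.-1 - d) * x ^+ k)).
(* The term [k = 0] vanishes because [d < p - 1] keeps the exponent of [0] positive. *)
by rewrite big_ltn ?prime_gt0 // expr0n subn_eq0 leqNgt dp mul0r add0r.
Qed.

Lemma fpolylog0 d : (d < p.-1)%N -> (fpolylog d).[0] = 0.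
Proof.
move=> dp; rewrite horner_coef0 coef_fpolylog prime_gt0 // expr0n.
by rewrite subn_eq0 leqNgt dp.
Qed.

Lemma mulX_deriv_fpolylog d : (d.+1 < p.-1)%N ->
  'X * (fpolylog d.+1)^`() = fpolylog d.
Proof.
move=> dp; apply/polyP => -[|i]; rewrite coefXM coef_fpolylog /=.
  by rewrite prime_gt0 // expr0n subn_eq0 leqNgt (ltnW dp).
rewrite coef_deriv coef_fpolylog; case: ifP => ip; last by rewrite mul0rn.
by rewrite -[LHS]mulr_natr -exprSr; congr (_ ^+ _); lia.
Qed.

Lemma deriv_fpolylog1 : (fpolylog 1)^`() = \poly_(i < p.-1) 1.
Proof.
apply/polyP => i; rewrite coef_deriv coef_fpolylog coef_poly.
have -> : (i.+1 < p)%N = (i < p.-1)%N by lia.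
case: ifP => ip; last by rewrite mul0rn.
rewrite -[LHS]mulr_natr -exprSr.
have -> : (p.-1 - 1).+1 = p.-1 by lia.
rewrite natr_Fermat //; apply/negP => /dvdn_leq; lia.
Qed.

Lemma deriv_fpolylog1E : (fpolylog 1)^`() = (1 - 'X) ^+ p.-1 - 'X ^+ p.-1.
Proof.
rewrite deriv_fpolylog1 expr_1BX_pred; apply/polyP => i.
rewrite coefB !coef_poly coefXn.
case: (ltngtP i p.-1) => ip; rewrite ?subr0.
- by have -> : (i < p)%N by lia.
- by have -> : (i < p)%N = false by lia.
- have -> : (i < p)%N by lia.
  by rewrite subrr.
Qed.

Lemma fpolylog_at1 d : (0 < d < p.-1)%N -> (fpolylog d).[1] = 0.
Proof.
move=> dp; rewrite horner_poly (eq_bigr (fun i : 'I_p => i%:R ^+ (p.-1 - d))).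
  by apply: natr_powersum; lia.
by move=> i _; rewrite expr1n mulr1.
Qed.

Lemma deriv_1BX : (1 - 'X)^`() = -1 :> {poly R}.
Proof. by rewrite derivB derivX -polyC1 derivC sub0r. Qed.

Lemma size_1BX : size (1 - 'X : {poly R}) = 2%N.
Proof. by rewrite -opprB size_polyN -polyC1 size_XsubC. Qed.

Lemma size_comp_1BX (f : {poly R}) n : (size f <= n)%N -> (size (f \Po (1 - 'X)) <= n)%N.
Proof.
move=> fn; apply: leq_trans fn; have [->|f0] := eqVneq f 0; first by rewrite comp_poly0.
by have := size_comp_poly_leq f (1 - 'X); rewrite size_1BX muln1 prednK ?size_poly_gt0.
Qed.

Lemma horner_comp_1BX (f : {poly R}) x : (f \Po (1 - 'X)).[x] = f.[1 - x].
Proof. by rewrite horner_comp !hornerE. Qed.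

(** The derivative in [deriv_fpolylog1E] changes sign under [X -> 1 - X], so both sides have the
    same derivative; both vanish at [0] and at [1]. *)
Lemma fpolylog1_refl : fpolylog 1 \Po (1 - 'X) = fpolylog 1.
Proof.
apply/eqP; rewrite -subr_eq0; apply/eqP; apply: deriv0_poly_eq0.
- rewrite derivB deriv_comp deriv_1BX deriv_fpolylog1E comp_polyB.
  rewrite !rmorphXn /= comp_polyX comp_polyB comp_polyX -polyC1 comp_polyC polyC1 subKr.
  by rewrite mulrN1 opprB subrr.
- have sz := size_fpolylog 1; apply: leq_trans (size_polyD _ _) _.
  rewrite geq_max size_polyN; have sz' := size_comp_1BX sz.
  have pp : (p <= p.*2)%N by lia.
  by rewrite (leq_trans sz) ?(leq_trans sz').
- by rewrite hornerD hornerN horner_comp_1BX subr0 fpolylog_at1 ?fpolylog0 ?subr0 //; lia.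
- by rewrite hornerD hornerN horner_comp_1BX subrr fpolylog_at1 ?fpolylog0 ?subr0 //; lia.
Qed.

(* Granville's congruence for the square of [fpolylog 1]: the left-hand side is a
   polynomial of degree less than [2 * p] with zero derivative. *)
Lemma fpolylog2_refl x :
  (x ^+ p * (fpolylog 2).[x] + (1 - x ^+ p) * (fpolylog 2).[1 - x]) *+ 2
    + (fpolylog 1).[x] ^+ 2 = 0.
Proof.
have dXp : ('X^p)^`() = 0 :> {poly R}.
  by rewrite derivXn -mulr_natr -polyC_natr pR polyC0 mulr0.
pose F := ('X^p * fpolylog 2 + (1 - 'X^p) * (fpolylog 2 \Po (1 - 'X))) *+ 2
  + fpolylog 1 ^+ 2.
have Fx y : F.[y] = (y ^+ p * (fpolylog 2).[y] + (1 - y ^+ p) * (fpolylog 2).[1 - y]) *+ 2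
    + (fpolylog 1).[y] ^+ 2.
  rewrite hornerD hornerMn hornerD !hornerM horner_comp_1BX.
  by rewrite hornerD hornerN hornerXn -polyC1 hornerC.
suff F0 : F = 0 by rewrite -Fx F0 horner0.
apply: deriv0_poly_eq0.
- rewrite /F; set G1 := fpolylog 1; set G2 := fpolylog 2.
  have e1 : 'X * G2^`() = G1 by apply: mulX_deriv_fpolylog; lia.
  have e2 : (1 - 'X) * (G2^`() \Po (1 - 'X)) = G1.
    by rewrite /G1 -fpolylog1_refl -/G1 -e1 comp_polyM comp_polyX.
  have e3 : G1^`() = (1 - 'X) ^+ p.-1 - 'X ^+ p.-1 by apply: deriv_fpolylog1E.
  have pS : p = p.-1.+1 by lia.
  (* Splitting one factor off [X ^ p] and off [(1 - X) ^ p], [e1] and [e2] turn the derivative of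
     the doubled bracket into [2 * (X ^ (p - 1) - (1 - X) ^ (p - 1)) * G1], which cancels the
     derivative of [G1 ^ 2] by [e3]. *)
  rewrite derivD derivMn derivD !derivM deriv_comp deriv_1BX derivB dXp.
  rewrite -polyC1 derivC polyC1 -Frobenius_1BX e3.
  have eX : 'X^p = 'X * 'X^(p.-1) :> {poly R} by rewrite -exprS -pS.
  have eY : (1 - 'X) ^+ p = (1 - 'X) * (1 - 'X) ^+ p.-1 :> {poly R} by rewrite -exprS -pS.
  rewrite {}eX {}eY; move: (_ \Po _) e2 => D'; move: (_^`()) e1 => D <-.
  move: (_ ^+ _) (_ ^+ _) => u v e2; apply/eqP.
  have := congr1 (fun f => f * u *+ 2) e2; rewrite /= => /eqP.
  by rewrite -subr_eq0 -oppr_eq0; congr (_ == 0); ring.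
- rewrite /F; have s1 := size_fpolylog 1; have s2 := size_fpolylog 2.
  have s2' := size_comp_1BX s2.
  apply: leq_trans (size_polyD _ _) _; rewrite geq_max; apply/andP; split; last first.
    by rewrite expr2 (leq_trans (size_polyMleq _ _)) //; lia.
  rewrite mulr2n; apply: leq_trans (size_polyD _ _) _; rewrite maxnn.
  apply: leq_trans (size_polyD _ _) _; rewrite geq_max; apply/andP; split.
    apply: leq_trans (size_polyMleq _ _) _; rewrite size_polyXn; lia.
  apply: leq_trans (size_polyMleq _ _) _; rewrite -opprB size_polyN size_XnsubC ?prime_gt0 //.
  by rewrite addSn -addnn leq_add2l.
- rewrite Fx expr0n subr0 fpolylog_at1; last by lia.
  by rewrite !fpolylog0 ?expr0n ?mulr0 ?addr0 ?mul0rn //; lia.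
- rewrite Fx expr1n !fpolylog_at1; try lia.
  by rewrite subrr mul0r mulr0 expr0n /= !addr0 mul0rn.
Qed.

(** Reverse the sum by [k -> p - k]: [p - k] reduces to [- k], which gives the sign since [p] is
    odd, and [x ^ (p - k) = x ^ p * y ^ k]. *)
Lemma fpolylog_inv d x y : x * y = 1 -> (d < p.-1)%N ->
  (fpolylog d).[x] = (-1) ^+ d * x ^+ p * (fpolylog d).[y].
Proof.
move=> xy dp.
rewrite !horner_fpolylog // big_nat_rev mulr_sumr; apply: eq_big_nat => k /andP[k0 kp].
rewrite add1n subSS natrB 1?ltnW // pR sub0r [X in X * _ = _]exprNn.
have -> : (-1) ^+ (p.-1 - d) = (-1) ^+ d :> R.
  rewrite -signr_odd oddB ?(ltnW dp) // -[in RHS]signr_odd.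
  by case: p p_gt1 prime_odd => //= n _ /negPf->.
have -> : x ^+ p = x ^+ (p - k) * x ^+ k by rewrite -exprD subnK // ltnW.
have xyk : x ^+ k * y ^+ k = 1 by rewrite -exprMn xy expr1n.
rewrite -!mulrA; congr (_ * _); rewrite mulrC; congr (_ * _).
by rewrite mulrCA xyk mulr1.
Qed.

(** * Values at a primitive cube root of unity *)

Section CubeRoot.
Variable z : R.
Hypothesis z1 : 1 + z + z ^+ 2 = 0.

Lemma cube_root_expr3 : z ^+ 3 = 1.
Proof. by apply/eqP; rewrite -subr_eq0 -(mulr0 (z - 1)) -z1; apply/eqP; ring. Qed.

Lemma cube_root_expr n : z ^+ n = z ^+ (n %% 3).
Proof. by rewrite {1}(divn_eq n 3) exprD mulnC exprM cube_root_expr3 expr1n mul1r. Qed.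

Lemma cube_root_sum n : 1 + z ^+ n + z ^+ n ^+ 2 = (if (3 %| n)%N then 3 else 0).
Proof.
rewrite -exprM cube_root_expr (cube_root_expr (n * 2)) -modnMml /dvdn.
case: (n %% 3)%N (ltn_pmod n (isT : 0 < 3)%N) => [|[|[|]]] //= _.
- by rewrite !expr0; ring.
- by rewrite -[RHS]z1 addrAC.
Qed.

Lemma prime_cube_root_sum : 1 + z ^+ p + z ^+ p ^+ 2 = 0.
Proof.
by rewrite cube_root_sum prime_dvd3.
Qed.

Lemma cube_root_mul : z * z ^+ 2 = 1.
Proof. by rewrite -exprS cube_root_expr3. Qed.

(** Put [u = z ^ p]. Inversion gives [G_2(z ^ 2) = u ^ 2 G_2(z)], so [G_2(z) + G_2(z ^ 2) = (1 + u ^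
    2) G_2(z) = - u G_2(z)], while [cube_root_sum] filters the multiples of [3] out of the left-hand
    side. *)
Lemma fpolylog2_cube_root :
  z ^+ p * (fpolylog 2).[z] = - (3 * \sum_(k < p | (3 %| k)%N) k%:R ^+ (p - 3)).
Proof.
set S0 := \sum_(_ < _ | _) _.
have p1 : (2 < p.-1)%N by lia.
have E : (fpolylog 2).[1] + (fpolylog 2).[z] + (fpolylog 2).[z ^+ 2] = 3 * S0.
  rewrite !horner_poly -!big_split /= mulr_sumr [RHS]big_mkcond /=.
  apply: eq_bigr => k _; rewrite expr1n -!mulrDr exprAC cube_root_sum.
  have -> : (p.-1 - 2 = p - 3)%N by lia.
  by case: ifP => _; rewrite ?mulr0 // mulrC.
rewrite fpolylog_at1 ?p1 // add0r in E.
have I := fpolylog_inv cube_root_mul p1; rewrite sqrrN expr1n mul1r in I.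
have u1 := prime_cube_root_sum; have z3 := cube_root_expr3.
have u3 : z ^+ p ^+ 3 = 1 by rewrite exprAC z3 expr1n.
rewrite -E; apply/eqP; rewrite -subr_eq0 opprK.
move: I u1 u3; set u := z ^+ p; set a := _.[z]; set b := _.[_] => I u1 u3.
have -> : u * a + (a + b) = (1 + u + u ^+ 2) * a + u ^+ 2 * (u * b - a) + (1 - u ^+ 3) * b by ring.
by rewrite u1 -I u3 !subrr !(mul0r, mulr0) !addr0.
Qed.

Lemma fpolylog1_cube_root :
  (fpolylog 1).[z ^+ 2] = - (z ^+ p ^+ 2 * (fpolylog 1).[z]).
Proof.
have p1 : (1 < p.-1)%N by lia.
have zz : z ^+ 2 * z = 1 by rewrite mulrC cube_root_mul.
by rewrite (fpolylog_inv zz p1) expr1 mulN1r mulNr exprAC.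
Qed.

(** [q] stands for the Fermat quotient of [3] and [H] for the Legendre symbol times the Bernoulli
    value; the integer factors avoid division in [R]. *)
Lemma fpolylog2_1Bcube_root q H :
  2 * (fpolylog 1).[z] = - (1 - z ^+ p) * q ->
  18 * \sum_(k < p | (3 %| k)%N) k%:R ^+ (p - 3) = H ->
  72 * (fpolylog 2).[1 - z] = 4 * (1 - z ^+ p ^+ 2) * H - 9 * (1 - z ^+ p) * q ^+ 2.
Proof.
move=> Eq <-; have := fpolylog2_refl z; have := fpolylog2_cube_root.
move: Eq prime_cube_root_sum; set u := z ^+ p; set S0 := \sum_(_ < _ | _) _.
move: (_.[1 - z]) (_.[z]) (_.[z]) => g a b Eq u1 Ea Eg.
apply/eqP; rewrite -subr_eq0; apply/eqP; apply: (@natr_lt_mul_eq0 3); first by lia.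
have {}Eg : 4 * ((- (3 * S0) + (1 - u) * g) *+ 2) + (- (1 - u) * q) ^+ 2 = 0.
  by rewrite -Ea -Eq -(mulr0 4) -Eg; ring.
(* Modulo [1 + u + u ^ 2], [(1 - u) * (1 - u ^ 2)] is [3], so multiplying [Eg] by [1 - u ^ 2]
   isolates [g] up to integer factors. *)
transitivity (9 * (1 - u ^+ 2) * (4 * ((- (3 * S0) + (1 - u) * g) *+ 2) + (- (1 - u) * q) ^+ 2)
  - 9 * (u - 2) * (1 + u + u ^+ 2) * (8 * g + (1 - u) * q ^+ 2)); first by ring.
by rewrite Eg u1 !(mul0r, mulr0) subr0.
Qed.
End CubeRoot.
End CharP.

(** * Bernoulli polynomials *)

Lemma size_bernoulli_seq n : size (bernoulli_seq n) = n.+1.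
Proof. by elim: n => //= n IHn; rewrite size_rcons IHn. Qed.

Lemma nth_bernoulli_seq n k : (k <= n)%N -> (bernoulli_seq n)`_k = bernoulli k.
Proof.
elim: n => [|n IHn]; first by rewrite leqn0 => /eqP ->.
rewrite leq_eqVlt => /predU1P[-> //|kn].
by rewrite /= nth_rcons size_bernoulli_seq kn IHn.
Qed.

Lemma bernoulliS n :
  bernoulli n.+1 = - \sum_(k < n.+1) 'C(n.+1, k)%:R * bernoulli k / (n.+1 - k).+1%:R.
Proof.
rewrite /bernoulli /= nth_rcons size_bernoulli_seq ltnn eqxx; congr (- _).
by apply: eq_bigr => k _; rewrite nth_bernoulli_seq // -ltnS.
Qed.

(** As [(n + 1) 'C(n, k) = (n - k + 1) 'C(n + 1, k)], this is the defining recurrence multiplied by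
    [n + 1]. *)
Lemma sum_bin_bernoulli n :
  \sum_(k < n.+1) 'C(n.+1, k)%:R * bernoulli k = (n == 0%N)%:R.
Proof.
transitivity (n.+1%:R * \sum_(k < n.+1) 'C(n, k)%:R * bernoulli k / (n - k).+1%:R).
  rewrite mulr_sumr; apply: eq_bigr => -[k kn] _ /=.
  have nz : (n - k).+1%:R != 0 :> rat by rewrite pnatr_eq0.
  have E : n.+1%:R * 'C(n, k)%:R = (n - k).+1%:R * 'C(n.+1, k)%:R :> rat.
    by rewrite -!natrM -subSn // -mul_bin_down.
  by rewrite !mulrA E; apply: (mulIf nz); rewrite divfK //; ring.
case: n => [|n]; first by rewrite big_ord1 /bernoulli /= bin0.
rewrite big_ord_recr /= subnn binn bernoulliS mul1r divr1 addrN mulr0 //.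
Qed.

Lemma horner_bernoulli_poly n x :
  (bernoulli_poly n).[x] = \sum_(k < n.+1) 'C(n, k)%:R * bernoulli k * x ^+ (n - k).
Proof.
by rewrite /bernoulli_poly horner_sum; apply: eq_bigr => k _; rewrite hornerZ hornerXn.
Qed.

Lemma bernoulli_poly_at0 n : (bernoulli_poly n).[0] = bernoulli n.
Proof.
rewrite horner_bernoulli_poly big_ord_recr /= big1 ?add0r ?subnn ?binn ?mulr1 ?mul1r //.
by move=> [k kn] _; rewrite expr0n subn_eq0 leqNgt kn mulr0.
Qed.

Lemma bernoulli_poly_at1 n : (bernoulli_poly n).[1] = bernoulli n + (n == 1%N)%:R.
Proof.
rewrite horner_bernoulli_poly; under eq_bigr do rewrite expr1n mulr1.
case: n => [|n]; first by rewrite big_ord1 /bernoulli /=.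
by rewrite big_ord_recr /= sum_bin_bernoulli binn mul1r addrC.
Qed.

Lemma deriv_bernoulli_poly n :
  (bernoulli_poly n.+1)^`() = n.+1%:R *: bernoulli_poly n.
Proof.
rewrite /bernoulli_poly big_ord_recr /= subnn derivD derivZ derivXn mulr0n scaler0 addr0.
rewrite raddf_sum scaler_sumr; apply: eq_bigr => -[k kn] _ /=.
rewrite derivZ derivXn -scaler_nat !scalerA subSn //=; congr (_ *: _).
by rewrite mulrAC mulrA -!natrM -subSn // mulnC -mul_bin_down.
Qed.

Lemma deriv_eq_rat (f g : {poly rat}) : f^`() = g^`() -> f.[0] = g.[0] -> f = g.
Proof.
move=> dfg fg0; apply/polyP => -[|i]; first by rewrite -!horner_coef0.
have := congr1 (fun h : {poly rat} => h`_i) dfg; rewrite !coef_deriv => /eqP.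
by rewrite eqrMn2r ?pnatr_eq0 //= => /eqP.
Qed.

(** By induction both sides have the same derivative; at [0] they agree by [bernoulli_poly_at1]. *)
Lemma bernoulli_poly_shift n :
  bernoulli_poly n \Po ('X + 1) = bernoulli_poly n + n%:R *: 'X^(n.-1).
Proof.
elim: n => [|n IHn].
  rewrite /bernoulli_poly big_ord1 expr0 scale0r addr0 linearZ /=.
  by rewrite -polyC1 comp_polyC.
apply: deriv_eq_rat.
  rewrite deriv_comp derivD derivX -polyC1 derivC addr0 mulr1 derivD derivZ derivXn.
  rewrite deriv_bernoulli_poly linearZ /= polyC1 IHn scalerDr.
  by rewrite !scaler_nat.
rewrite horner_comp !hornerE bernoulli_poly_at1 bernoulli_poly_at0 expr0n.
by case: n {IHn} => [|n]; rewrite /= ?mulr0 ?mulr1.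
Qed.

(** Let [D m] be the difference of the two sides for [m]. If [D n = 0], then [D (n + 1)] is a
    constant [c] and [D (n + 2)] is affine of slope [- (n + 2) c]; its values at [0] and [1] agree,
    so [c = 0]. *)
Lemma bernoulli_poly_refl n :
  bernoulli_poly n \Po (1 - 'X) = (-1) ^+ n *: bernoulli_poly n.
Proof.
pose D m : {poly rat} := bernoulli_poly m \Po (1 - 'X) - (-1) ^+ m *: bernoulli_poly m.
have dD m : (D m.+1)^`() = - (m.+1%:R *: D m).
  rewrite /D derivB derivZ deriv_comp derivB derivX -polyC1 derivC sub0r mulrN1.
  rewrite polyC1 deriv_bernoulli_poly linearZ /= exprS scalerBr opprB.
  rewrite !scalerA mulN1r !mulNr scaleNr opprK addrC; congr (_ *: _ - _); ring.
have D01 m : (1 < m)%N -> (D m).[1] = (D m).[0].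
  move=> m1; rewrite /D !hornerD !hornerN !hornerZ !horner_comp !hornerE subrr.
  rewrite bernoulli_poly_at1 bernoulli_poly_at0.
  by case: m m1 => [|[|m]] //= _; rewrite addr0.
suff : D n = 0 by move/eqP; rewrite subr_eq0 => /eqP.
elim: n => [|n IHn].
  by rewrite /D /bernoulli_poly big_ord1 expr0 scale1r linearZ /= -polyC1 comp_polyC subrr.
have Dc : D n.+1 = (D n.+1).[0]%:P.
  by apply: deriv_eq_rat; rewrite ?hornerC // dD IHn scaler0 oppr0 derivC.
have DX : D n.+2 = (- (n.+2%:R * (D n.+1).[0])) *: 'X + (D n.+2).[0]%:P.
  apply: deriv_eq_rat; last by rewrite !hornerE.
  by rewrite dD {1}Dc derivD derivC addr0 derivZ derivX scaleNr -mul_polyC -polyCM alg_polyC.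
have := D01 n.+2 isT; rewrite {1}DX hornerD hornerC hornerZ hornerX mulr1.
move/eqP; rewrite -subr_eq0 addrK oppr_eq0 mulf_eq0 pnatr_eq0 /= => /eqP c0.
by rewrite Dc c0.
Qed.

(** Telescoping [bernoulli_poly_shift] links Bernoulli polynomials to power sums. *)
Lemma bernoulli_poly_nat n N :
  (bernoulli_poly n).[N%:R] = bernoulli n + n%:R * \sum_(k < N) k%:R ^+ n.-1.
Proof.
elim: N => [|N IHN]; first by rewrite big_ord0 mulr0 addr0 bernoulli_poly_at0.
have := congr1 (fun f => f.[N%:R]) (bernoulli_poly_shift n).
rewrite /= horner_comp !hornerE IHN -natr1 => ->.
by rewrite big_ord_recr /=; ring.
Qed.

Lemma bernoulli_odd n : odd n -> (1 < n)%N -> bernoulli n = 0.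
Proof.
move=> on n1; have := congr1 (fun f => f.[0]) (bernoulli_poly_refl n).
rewrite /= horner_comp !hornerE bernoulli_poly_at1 bernoulli_poly_at0.
rewrite -signr_odd on expr1 mulN1r; case: n {on} n1 => [|[|n]] //= _.
by rewrite addr0 => /eqP; rewrite -addr_eq0 -mulr2n mulrn_eq0 /= => /eqP.
Qed.

(** * Localization at [p] and its residue ring *)

(* [Z_(p)[sqrt (-3)]]; membership is decided classically only to make this a
   boolean predicate, as the subring and quotient constructions require. *)
Definition local_pred (p : nat) : {pred algC} :=
  fun x => boolp.asbool (x \in Qsqrtm3 /\
    exists2 m : nat, coprime m p & m%:R * x \in Aint).

Lemma local_predP p x :
  reflect (x \in Qsqrtm3 /\ exists2 m : nat, coprime m p & m%:R * x \in Aint)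
    (x \in local_pred p).
Proof. exact: boolp.asboolP. Qed.

Lemma Qsqrtm3_mul x y : x \in Qsqrtm3 -> y \in Qsqrtm3 -> x * y \in Qsqrtm3.
Proof.
case/Qsqrtm3P=> a [b ->] /Qsqrtm3P[c [d ->]].
apply/Qsqrtm3P; exists (a * c - b * d * 3), (a * d + b * c).
have -> : ratr (a * c - b * d * 3) = ratr a * ratr c + ratr b * ratr d * (sqrtm3 * sqrtm3).
  by rewrite sqrtm3_sqr rmorphB !rmorphM /= (rmorph_nat (@ratr algC) 3); ring.
by rewrite rmorphD !rmorphM /=; ring.
Qed.

Lemma local_subring p : subring_closed (local_pred p).
Proof.
split=> [|x y /local_predP[Kx [m mp Ax]] /local_predP[Ky [n np Ay]]
         |x y /local_predP[Kx [m mp Ax]] /local_predP[Ky [n np Ay]]]; apply/local_predP; split.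
- by rewrite mem_Crat_span ?mem_head.
- by exists 1%N; rewrite ?coprime1n // mulr1 Aint1.
- exact: rpredB.
- exists (m * n)%N; first by rewrite coprimeMl mp.
  have -> : (m * n)%:R * (x - y) = n%:R * (m%:R * x) - m%:R * (n%:R * y) by ring.
  by rewrite rpredB // rpredM // rpred_nat.
- exact: Qsqrtm3_mul.
- exists (m * n)%N; first by rewrite coprimeMl mp.
  by rewrite natrM mulrACA rpredM.
Qed.

HB.instance Definition _ (p : nat) :=
  GRing.isSubringClosed.Build algC (local_pred p) (@local_subring p).

Record local_ring (p : nat) := LocalRing { locval : algC; _ : locval \in local_pred p }.

HB.instance Definition _ (p : nat) := [isSub for @locval p].
HB.instance Definition _ (p : nat) := [Choice of local_ring p by <:].
HB.instance Definition _ (p : nat) := [SubChoice_isSubComNzRing of local_ring p by <:].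

Lemma local_predV p m x : coprime m p -> x \in local_pred p -> x / m%:R \in local_pred p.
Proof.
move=> mp xL; rewrite mulrC; apply: rpredM => //; apply/local_predP; split.
  have [->|m0] := eqVneq m 0%N; first by rewrite invr0 rpred0.
  apply/Qsqrtm3P; exists m%:R^-1, 0; rewrite rmorph0 mul0r addr0 fmorphV.
  by rewrite rmorph_nat.
exists m => //; have [->|m0] := eqVneq m 0%N; first by rewrite mul0r.
by rewrite divff ?Aint1 // pnatr_eq0.
Qed.

Lemma local_pred_sqrtm3 p : sqrtm3 \in local_pred p.
Proof.
apply/local_predP; split; first by rewrite mem_Crat_span // inE mem_head orbT.
exists 1%N; rewrite ?coprime1n // mul1r.
apply: (@root_monic_Aint ('X^2 - (-3)%:P)).
- by rewrite rootE !hornerE expr2 sqrtm3_sqr subrr.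
- by rewrite monicXnsubC.
- apply/polyOverP=> i; rewrite coefB coefC coefXn rpredB ?rpred_nat //.
  by case: ifP; rewrite ?rpredN ?rpred_nat ?rpred0.
Qed.

(** One denominator [m] serves all [P] above [p]: if [m] were in [P], Bezout's relation between [m]
    and [p] would put [1] in [P]. *)
Lemma integral_above_local p x : prime p -> x \in local_pred p -> integral_above p x.
Proof.
move=> pp /local_predP[Kx [m mp Ax]]; split=> // P idP _ pP.
have m0 : m != 0%N by apply: contraTneq mp => ->; rewrite /coprime gcd0n; case: p pp {pP} => [|[]].
have mxK : m%:R * x \in intQsqrtm3.
  apply/andP; split; last exact: Ax.
  apply: Qsqrtm3_mul => //; apply/Qsqrtm3P; exists m%:R, 0.
  by rewrite rmorph0 mul0r addr0 rmorph_nat.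
exists (MkOQsqrtm3 mxK), m%:R; split; last first.
  rewrite (rmorph_nat (\val : {rmorphism OQsqrtm3 -> algC})) mulrC mulKf //.
  by rewrite pnatr_eq0.
apply/negP => mP; case: idP => P0 /negP P1 idP; apply: P1.
case: (@egcdnP m p) => [|u w E _]; first by rewrite lt0n.
have E1 : u%:R * m%:R + (- w%:R * p%:R + 0) = 1 :> OQsqrtm3.
  by rewrite -natrM E (eqP mp) natrD natrM; ring.
by rewrite -E1; exact: (idP _ _ _ mP (idP _ _ _ pP P0)).
Qed.

Definition local_val p : {rmorphism local_ring p -> algC} := val.
Arguments local_val {p}.

Lemma local_val_inj p : injective (local_val : local_ring p -> algC).
Proof. exact: val_inj. Qed.

Lemma local_valP p (x : local_ring p) : local_val x \in local_pred p.
Proof. exact: valP. Qed.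

Lemma local_val_onto p x : x \in local_pred p -> exists a : local_ring p, local_val a = x.
Proof. by move=> xL; exists (LocalRing xL). Qed.

Section Residue.
Variables (p : nat) (p_gt1 : (1 < p)%N).

(* The unused argument lets the instance below, which needs [1 < p], be inferred. *)
Definition local_ideal of (1 < p)%N : {pred local_ring p} :=
  [pred x | local_val x / p%:R \in local_pred p].

Lemma local_ideal_closed : idealr_closed (local_ideal p_gt1).
Proof.
split.
- by rewrite inE rmorph0 mul0r rpred0.
(* The ideal is proper: otherwise [m / p], for some [m] coprime to [p], would be a rational
   algebraic integer, hence an integer. *)
- rewrite inE rmorph1 mul1r; apply/negP => /local_predP[_ [m mp]].
  have p0 : p%:R != 0 :> algC by rewrite pnatr_eq0; case: p p_gt1.
  move/Cint_rat_Aint; rewrite rpred_div ?rpred_nat // => /(_ isT)/intrP[n E].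
  have {}E : m%:R = (n * p%:R)%:~R :> algC by rewrite intrM -E rmorph_nat divfK.
  move: E => /eqP; rewrite -[m%:R]/(m%:~R) eqr_int => /eqP E.
  have : (p %| m)%N by have := congr1 absz E; rewrite abszM natz /= => ->; apply: dvdn_mull.
  by move=> pm; move: mp; rewrite /coprime; move/gcdn_idPr: pm => ->; case: p p_gt1 => [|[]].
- move=> a x y; rewrite !inE => xI yI.
  rewrite rmorphD rmorphM mulrDl -mulrA; apply: rpredD => //; apply: rpredM => //.
  exact: local_valP.
Qed.

HB.instance Definition _ :=
  isIdealr.Build (local_ring p) (local_ideal p_gt1) local_ideal_closed.

Definition residue_ring : comNzRingType := {ideal_quot (local_ideal p_gt1)}.

Definition residue : {rmorphism local_ring p -> residue_ring} :=
  (\pi_{ideal_quot (local_ideal p_gt1)})%qT.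

Lemma residue_eq x y :
  residue x = residue y -> (local_val x - local_val y) / p%:R \in local_pred p.
Proof.
by move/eqP; rewrite -(Quotient.idealrBE (local_ideal p_gt1)) inE rmorphB.
Qed.

Lemma residue_p : p%:R = 0 :> residue_ring.
Proof.
rewrite -(rmorph_nat residue) -(rmorph0 residue); apply/eqP.
rewrite -(Quotient.idealrBE (local_ideal p_gt1)) inE subr0 rmorph_nat.
by rewrite divff ?rpred1 // pnatr_eq0; case: p p_gt1.
Qed.

End Residue.

(** * Lifting to characteristic zero *)

Section Lift.
Variables (p : nat) (R A : comNzRingType) (f : {rmorphism A -> R}).
Hypotheses (p_prime : prime p) (p_gt3 : (3 < p)%N) (pR : p%:R = 0 :> R).

(** The inner binomial coefficients are [p] times ['C(p, k) / p], which reduces to [- (-1) ^ k / k];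
    this is how [G_1] measures the failure of additivity of the [p]-th power modulo [p ^ 2]. *)
Lemma expr1B_prime (x : A) :
  exists2 X, (1 - x) ^+ p = 1 - x ^+ p - p%:R * X & f X = (fpolylog p R 1).[f x].
Proof.
exists (- \sum_(1 <= k < p) (- x) ^+ k *+ ('C(p, k) %/ p)).
  rewrite mulrN opprK mulr_sumr exprDn.
  rewrite -(big_mkord predT (fun k => (1 ^+ (p - k) * (- x) ^+ k) *+ 'C(p, k))).
  rewrite big_ltn // big_nat_recr ?prime_gt0 //= subn0 expr1n bin0 !mul1r binn subnn.
  have -> : (- x) ^+ p = - x ^+ p.
    by rewrite exprNn -signr_odd prime_odd // mulN1r.
  rewrite expr0 !mulr1n mul1r addrA [in RHS]addrAC; congr (_ + _ - _).
  apply: eq_big_nat => k /andP[k0 kp]; rewrite expr1n mul1r mulr_natl -mulrnA.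
  by rewrite divnK // prime_dvd_bin // k0.
rewrite (horner_fpolylog p_prime); last by lia.
rewrite rmorphN rmorph_sum -sumrN; apply: eq_big_nat => k kp.
rewrite rmorphMn rmorphXn rmorphN -mulr_natr (natr_bin_div p_prime pR kp).
have -> : (p.-1 - 1 = p - 2)%N by lia.
rewrite (exprNn (f x) k); have s1 : (-1) ^+ k * (-1) ^+ k = 1 :> R by rewrite -expr2 sqrr_sign.
move: ((-1) ^+ k) s1 (k%:R ^+ _) (f x ^+ k) => s s1 K y.
by transitivity (s * s * (K * y)); [ring | rewrite s1 mul1r].
Qed.

(* Raise [(1 - z) * (1 - z ^ 2) = 3] to the power [p] and expand both factors
   modulo [p ^ 2] with [expr1B_prime]. *)
Lemma fpolylog1_Fermat_quotient (z q : A) :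
    1 + z + z ^+ 2 = 0 -> p%:R * q = 3 ^+ p.-1 - 1 -> GRing.lreg (p%:R : A) ->
  2 * (fpolylog p R 1).[f z] = - (1 - f z ^+ p) * f q.
Proof.
move=> z1 Eq preg; have [X EX fX] := expr1B_prime z; have [Y EY fY] := expr1B_prime (z ^+ 2).
have fz1 : 1 + f z + f z ^+ 2 = 0 by rewrite -rmorphXn -[1](rmorph1 f) -!rmorphD z1 rmorph0.
have z13 : (1 - z) * (1 - z ^+ 2) = 3.
  transitivity (3 + (z - 2) * (1 + z + z ^+ 2)); first by ring.
  by rewrite z1 mulr0 addr0.
have u1 : 1 + z ^+ p + z ^+ p ^+ 2 = 0 by apply: prime_cube_root_sum.
have u13 : (1 - z ^+ p) * (1 - z ^+ p ^+ 2) = 3.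
  transitivity (3 + (z ^+ p - 2) * (1 + z ^+ p + z ^+ p ^+ 2)); first by ring.
  by rewrite u1 mulr0 addr0.
have E : 3 * q = - ((1 - z ^+ p) * Y + (1 - z ^+ p ^+ 2) * X) + p%:R * (X * Y).
  apply: preg; rewrite mulrCA Eq.
  have -> : 3 * (3 ^+ p.-1 - 1) = 3 ^+ p - 3 :> A.
    by rewrite mulrBr -exprS prednK ?prime_gt0 // mulr1.
  rewrite -{1}z13 exprMn EX EY -u13 (exprAC z 2 p); ring.
have {}E := congr1 f E.
have /eqP := E; rewrite rmorphM rmorph_nat rmorphD rmorphN rmorphD !rmorphM !rmorphB.
rewrite !rmorphXn rmorph1 rmorph_nat pR mul0r addr0 fX fY rmorphXn fpolylog1_cube_root //.
have := prime_cube_root_sum p_prime p_gt3 fz1.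
move: (f z ^+ p) (_.[_]) (f q) => u g fq U1 /eqP {}E.
apply/eqP; rewrite -subr_eq0; apply/eqP.
apply: (@natr_lt_mul_eq0 p R p_prime pR 3); first by lia.
(* Since [u ^ 3 = 1], [E] says that [3 * fq = - 2 * (1 - u ^ 2) * g]; the factor [1 - u] then turns
   [1 - u ^ 2] into [3]. *)
transitivity ((1 - u) * (3 * fq + ((1 - u) * (- (u ^+ 2 * g)) + (1 - u ^+ 2) * g))
  + (1 + u + u ^+ 2) * g * (u ^+ 2 - 4 * u + 5)).
  by ring.
by rewrite E U1 addNr mulr0 !mul0r addr0.
Qed.

End Lift.

(** * Polylogarithms and Bernoulli values in the residue ring *)

Section Local.
Variables (p : nat) (p_prime : prime p) (p_gt3 : (3 < p)%N).
Let p_gt1 : (1 < p)%N := prime_gt1 p_prime.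
Local Notation A := (local_ring p).
Local Notation R := (residue_ring p_gt1).
Local Notation v := (@local_val p).
Local Notation pi := (residue p_gt1).
Let pR : p%:R = 0 :> R := residue_p p_gt1.

Lemma coprime_lt k : (0 < k < p)%N -> coprime k p.
Proof.
by case/andP=> k0 kp; rewrite coprime_sym prime_coprime //; apply/negP => /dvdn_leq; lia.
Qed.

Lemma polylog_residue d (x : A) : (d < p.-1)%N ->
  exists2 a : A, v a = polylog p d (v x) & pi a = (fpolylog p R d).[pi x].
Proof.
(* The default [0] is harmless: only [0 < k < p] occurs, where [1 / k] lies in the local ring. *)
move=> dp; pose i k : A := insubd 0 (k%:R^-1).
have vi k : (0 < k < p)%N -> v (i k) = k%:R^-1.
  move=> kp; rewrite /local_val /= insubdK // -[_^-1]mul1r.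
  by apply: local_predV; rewrite ?rpred1 ?coprime_lt.
have ik k : (0 < k < p)%N -> k%:R * i k = 1.
  move=> kp; apply: local_val_inj; rewrite rmorphM rmorph_nat vi // rmorph1 divff //.
  by rewrite pnatr_eq0 -lt0n; case/andP: kp.
exists (\sum_(1 <= k < p) x ^+ k * i k ^+ d).
  rewrite rmorph_sum; apply: eq_big_nat => k kp.
  by rewrite rmorphM !rmorphXn vi // exprVn.
rewrite horner_fpolylog // rmorph_sum; apply: eq_big_nat => k kp.
rewrite rmorphM !rmorphXn mulrC; congr (_ * _).
apply/eqP; rewrite -subr_eq0; apply/eqP.
apply: (@natr_mul_eq0 p R p_prime pR (k ^ d)).
  by rewrite -prime_coprime // coprime_sym coprimeXl // coprime_lt.
rewrite natrX mulrBr -exprMn -{1}[k%:R](rmorph_nat pi) -rmorphM ik // rmorph1 expr1n.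
rewrite -exprD subnKC 1?ltnW // natr_Fermat ?subrr //.
by rewrite -prime_coprime // coprime_sym coprime_lt.
Qed.

(** The recurrence for [bernoulli n] divides only by integers up to [n + 1], all prime to [p]. *)
Lemma ratr_bernoulli_local n : (n.+1 < p)%N -> ratr (bernoulli n) \in local_pred p.
Proof.
elim/ltn_ind: n => -[|n] IHn np; first by rewrite rmorph1 rpred1.
rewrite bernoulliS rmorphN rpredN rmorph_sum rpred_sum // => k _.
rewrite fmorph_div rmorphM !rmorph_nat; apply: local_predV.
  by apply: coprime_lt; have := ltn_ord k; lia.
by rewrite rpredM ?rpred_nat // IHn //; have := ltn_ord k; lia.
Qed.

(** Hence the value of [g] modulo [p] depends only on the argument modulo [p]. *)
Lemma horner_local_sub (g : {poly algC}) x y :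
    (forall k, g`_k \in local_pred p) -> x \in local_pred p -> y \in local_pred p ->
  exists2 c, c \in local_pred p & g.[x] - g.[y] = (x - y) * c.
Proof.
move=> gL xL yL.
exists (\sum_(k < size g) g`_k * \sum_(i < k) x ^+ (k.-1 - i) * y ^+ i).
  apply: rpred_sum => k _; apply: rpredM => //.
  by apply: rpred_sum => i _; rewrite rpredM ?rpredX.
rewrite !horner_coef -sumrB mulr_sumr; apply: eq_bigr => k _.
by rewrite -mulrBr subrXX mulrCA.
Qed.

(* Modulo [p], [r] may be replaced by the natural number [N], where the value of
   the Bernoulli polynomial is a power sum. *)
Lemma bernoulli_poly_local (r : rat) N :
    ratr r \in local_pred p -> (ratr r - N%:R) / p%:R \in local_pred p ->
  exists2 b : A, v b = ratr (bernoulli_poly (p - 2)).[r] &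
    pi b = - 2 * \sum_(k < N) k%:R ^+ (p - 3).
Proof.
move=> rL rN; have podd := prime_odd p_prime p_gt3.
pose g : {poly algC} := map_poly ratr (bernoulli_poly (p - 2)).
have gL k : g`_k \in local_pred p.
  rewrite coef_map /= /bernoulli_poly coef_sum rmorph_sum rpred_sum // => i _.
  rewrite coefZ coefXn !rmorphM !rmorph_nat rpredM ?rpred_nat // rpredM ?rpred_nat //.
  by apply: ratr_bernoulli_local; have := ltn_ord i; lia.
have [c cL Ec] := horner_local_sub gL rL (rpred_nat _ N).
have bL : ratr (bernoulli_poly (p - 2)).[r] \in local_pred p.
  rewrite -horner_map -/g horner_coef rpred_sum // => i _.
  by rewrite rpredM ?rpredX.
have [b Eb] := local_val_onto bL; exists b => //.
(* This is the Bernoulli polynomial at [N]: its constant term [bernoulli (p - 2)] is [0], as [p - 2]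
   is odd and exceeds [1]. *)
pose b' : A := (p - 2)%:R * \sum_(k < N) k%:R ^+ (p - 3).
transitivity (pi b').
  have [a Ea] := local_val_onto (rpredM rN cL).
  have pp0 : pi p%:R = 0 by rewrite rmorph_nat; exact: pR.
  suff -> : b = b' + p%:R * a by rewrite rmorphD (rmorphM _ p%:R) pp0 mul0r addr0.
  apply: local_val_inj; rewrite Eb rmorphD (rmorphM _ p%:R) rmorph_nat Ea.
  rewrite -horner_map -/g -[LHS](subrK g.[N%:R]) Ec addrC.
  have p0 : p%:R != 0 :> algC by rewrite pnatr_eq0 -lt0n prime_gt0.
  congr (_ + _); last by rewrite mulrA mulrCA divff ?mulr1.
  rewrite -(rmorph_nat (@ratr algC)) horner_map bernoulli_poly_nat bernoulli_odd; try lia.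
  rewrite add0r /b' !rmorphM !rmorph_nat !rmorph_sum; congr (_ * _).
  by apply: eq_bigr => k _; rewrite !rmorphXn !rmorph_nat; congr (_ ^+ _); lia.
rewrite /b' rmorphM rmorph_nat natrB ?pR ?sub0r; last by lia.
by congr (_ * _); rewrite rmorph_sum; apply: eq_bigr => k _; rewrite rmorphXn rmorph_nat.
Qed.

Lemma legendre3 : legendre p 3 = if (p %% 3 == 1)%N then 1 else -1.
Proof.
have p3 := prime_dvd3 p_prime p_gt3.
rewrite /legendre p3; case: eqP => p1.
  by case: existsP => // -[]; exists (@Ordinal 3 1 isT); rewrite p1.
case: existsP => // -[[[|[|[|x]]] x3]] //=; rewrite eq_sym => /eqP E.
- by move: p3; rewrite /dvdn E.
- by case: p1; rewrite E.
- by case: p1; rewrite E.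
Qed.

(** Write [p = 3 n + m] with [m] in [{1, 2}]. Then [(3 - m) / 3 - (n + 1) = - p / 3], so [n + 1]
    represents [2/3] or [1/3] modulo [p]. For [m = 1] the reflection to [1/3] costs a sign, which
    the Legendre symbol records. *)
Lemma bernoulli_poly_third :
  exists2 b : A, v b = ratr (bernoulli_poly (p - 2)).[1 / 3] &
    18 * \sum_(k < p | (3 %| k)%N) k%:R ^+ (p - 3) = (legendre p 3)%:~R * pi b :> R.
Proof.
have podd := prime_odd p_prime p_gt3.
set n := (p %/ 3)%N.
have p3 := prime_dvd3 p_prime p_gt3.
have div3L m : m%:R / 3 \in local_pred p.
  by apply: local_predV; rewrite ?rpred_nat // coprime_lt // p_gt3.
have p0 : p%:R != 0 :> algC by rewrite pnatr_eq0 -lt0n prime_gt0.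
have lift (m : nat) (E : p = (3 * n + m)%N) : (0 < m < 3)%N ->
    exists2 b : A, v b = ratr (bernoulli_poly (p - 2)).[(3 - m)%:R / 3]
      & pi b = - 2 * \sum_(k < n.+1) k%:R ^+ (p - 3).
  move=> m0; apply: bernoulli_poly_local => //; rewrite fmorph_div !rmorph_nat //.
  have -> : ((3 - m)%:R / 3 - n.+1%:R) / p%:R = - (1%:R / 3) :> algC.
    have Ep : p%:R = 3 * n%:R + m%:R :> algC by rewrite {1}E natrD natrM.
    apply: (mulIf p0); rewrite divfK // natrB ?Ep -?natr1; last by case/andP: m0 => _ /ltnW.
    by field.
  by rewrite rpredN.
have ES : 18 * \sum_(k < p | (3 %| k)%N) k%:R ^+ (p - 3)
    = 2 * \sum_(k < n.+1) k%:R ^+ (p - 3) :> R.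
  rewrite (big_ord_dvd3 (fun k => k%:R ^+ (p - 3))).
  have -> : ((p + 2) %/ 3 = n.+1)%N by move: p3; rewrite /n /dvdn; lia.
  under eq_bigr => j _ do rewrite natrM exprMn.
  have F3 : 3 ^+ p.-1 = 1 :> R.
    by apply: natr_Fermat; rewrite // -prime_coprime // coprime_sym coprime_lt ?p_gt3.
  rewrite -mulr_sumr mulrA; congr (_ * _).
  (* [18 * 3 ^ (p - 3)] is [2 * 3 ^ (p - 1)], which is [2] by Fermat. *)
  transitivity (2 * 3 ^+ p.-1 : R); last by rewrite F3 mulr1.
  have -> : p.-1 = (p - 3).+2 by lia.
  by rewrite !exprS; ring.
rewrite {}ES legendre3; case: eqP => p1.
  have [|b Eb Pb] := lift 1%N _ isT; first by rewrite /n; lia.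
  exists (- b); last by rewrite mul1r rmorphN Pb; ring.
  rewrite rmorphN Eb -rmorphN; congr ratr.
  have := congr1 (fun f => f.[2 / 3]) (bernoulli_poly_refl (p - 2)).
  rewrite horner_comp !hornerE -signr_odd oddB ?podd; last by lia.
  have -> : 1 - 2 / 3 = 1 / 3 :> rat by [].
  by move=> ->; rewrite expr1 mulN1r.
have [|b Eb Pb] := lift 2%N _ isT; first by move: p3; rewrite /n /dvdn; lia.
by exists b; rewrite // Pb; ring.
Qed.

(** [N] clears the denominators of both sides, so the comparison takes place in the residue ring;
    being prime to [p], it can be divided out again. *)
Lemma cong_mod_residue N (a b : A) x y : coprime N p ->
  v a = N%:R * x -> v b = N%:R * y -> pi a = pi b -> cong_mod p x y.
Proof.
move=> Np Ea Eb /residue_eq; rewrite Ea Eb => ab.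
have N0 : N%:R != 0 :> algC.
  by rewrite pnatr_eq0; apply: contraTneq Np => ->; rewrite /coprime gcd0n gtn_eqF.
apply: integral_above_local => //.
suff -> : (x - y) / p%:R = (N%:R * x - N%:R * y) / p%:R / N%:R by exact: local_predV.
by rewrite -mulrBr -[N%:R * _ / _]mulrA [N%:R * _]mulrC mulfK.
Qed.

End Local.

Theorem theorem4p3 (p : nat) (p_prime : prime p) (p_gt3 : (3 < p)%N)
    (e : int) (e_sign : e = 1 \/ e = -1) :
  let s : algC := e%:~R in
  let q : algC := ratr (fermat_quotient p 3) in
  let L : algC := (legendre p 3)%:~R in
  let B : algC := ratr (bernoulli_poly (p - 2)).[1 / 3] in
  cong_mod p (polylog p 2 (1 + omega6 ^ e))
    (- (q ^+ 2 / 16) * (3 + s * sqrtm3 * L)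
     + 1 / 36 * (3 * L - s * sqrtm3) * B)
  /\
  cong_mod p (polylog p 2 ((1 + omega6 ^ e) / 3))
    (- (q ^+ 2 / 8) + 1 / 36 * (L + s * sqrtm3) * B).
Proof.
move=> s q L B.
pose p_gt1 := prime_gt1 p_prime.
pose A := local_ring p; pose R := residue_ring p_gt1.
pose v : {rmorphism A -> algC} := local_val; pose pi : {rmorphism A -> R} := residue p_gt1.
have pR : p%:R = 0 :> R := residue_p p_gt1.
have p0 : p%:R != 0 :> algC by rewrite pnatr_eq0 -lt0n prime_gt0.
have vinj : injective v := @local_val_inj p.
have [r vr] : exists r : A, v r = sqrtm3 := local_val_onto (local_pred_sqrtm3 p).
have [h vh] : exists h : A, v h = 1 / 2.
  apply: local_val_onto; apply: local_predV; rewrite ?rpred1 //.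
  by apply: (coprime_lt p_prime); lia.
have [t vt] : exists t : A, v t = 1 / 3.
  apply: local_val_onto; apply: local_predV; rewrite ?rpred1 //.
  by apply: (coprime_lt p_prime); lia.
have [q' vq pq] : exists2 q' : A, v q' = q & p%:R * q' = 3 ^+ p.-1 - 1.
  have pd : (p %| 3 ^ p.-1 - 1)%N.
    by apply: dvdn_Fermat; rewrite // -prime_coprime // coprime_sym (coprime_lt p_prime) ?p_gt3.
  exists ((3 ^ p.-1 - 1) %/ p)%:R; last first.
    by rewrite -natrM mulnC divnK // natrB ?expn_gt0 // natrX.
  rewrite rmorph_nat /q /fermat_quotient fmorph_div rmorphB rmorphXn !rmorph_nat rmorph1.
  apply: (mulIf p0); rewrite divfK // -natrM divnK // natrB ?expn_gt0 // natrX //.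
have [b vb Pb] := bernoulli_poly_third p_prime p_gt3; rewrite -/B in vb.
pose l : A := (legendre p 3)%:~R; pose s' : A := e%:~R.
have s2 : s' ^+ 2 = 1.
  by rewrite /s'; case: e_sign => ->; rewrite ?rmorphN1 ?sqrrN expr1n.
have l2 : l ^+ 2 = 1.
  by rewrite /l legendre3 //; case: ifP => _; rewrite ?rmorphN1 ?sqrrN expr1n.
have r2 : r ^+ 2 = -3.
  by apply: vinj; rewrite rmorphXn vr expr2 sqrtm3_sqr rmorphN rmorph_nat.
have h2 : 2 * h = 1.
  by apply: vinj; rewrite rmorphM rmorph_nat vh mul1r divff ?rmorph1 ?pnatr_eq0.
have t3 : 3 * t = 1.
  by apply: vinj; rewrite rmorphM rmorph_nat vt mul1r divff ?rmorph1 // pnatr_eq0.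
pose w : A := (1 + s' * r) * h; pose z := - w.
have vw : v w = omega6 ^ e.
  rewrite rmorphM rmorphD rmorph1 rmorphM rmorph_int vr vh /omega6.
  case: e_sign => ->; first by rewrite expr1z !mul1r.
  (* For [e = -1]: the conjugate of [omega6] is its inverse, as its norm is [1]. *)
  rewrite mulN1r mul1r exprN1.
  have om : (1 - sqrtm3) / 2 * ((1 + sqrtm3) / 2) = 1.
    transitivity ((1 - sqrtm3 * sqrtm3) / 4); first by field.
    by rewrite sqrtm3_sqr; field.
  have om0 : (1 + sqrtm3) / 2 != 0.
    by apply/eqP => o0; move/eqP: om; rewrite o0 mulr0 eq_sym oner_eq0.
  by apply: (mulIf om0); rewrite om mulVf.
have z1 : 1 + z + z ^+ 2 = 0.
  transitivity ((1 - 2 * h) * (1 + h - s' * r * h) + (s' ^+ 2 * r ^+ 2 + 3) * h ^+ 2).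
    by rewrite /z /w; ring.
  by rewrite h2 subrr !mul0r add0r s2 mul1r r2 addNr mul0r.
(* [z ^ p] is [z] or its conjugate [z ^ 2] according to [p] modulo [3]; the symbol [l] carries the
   sign of [r]. *)
have zp : z ^+ p = - ((1 + s' * l * r) * h).
  rewrite (cube_root_expr z1) /l legendre3 //; case: eqP => p1.
    by rewrite p1 expr1 rmorph1 mulr1.
  have -> : (p %% 3 = 2)%N.
    by have := prime_dvd3 p_prime p_gt3; rewrite /dvdn; lia.
  rewrite rmorphN1; apply/eqP; rewrite -subr_eq0; apply/eqP.
  transitivity (1 + z + z ^+ 2 - (1 - 2 * h)); first by rewrite /z /w; ring.
  by rewrite z1 h2 subrr subr0.
have preg : GRing.lreg (p%:R : A).
  move=> x y /(congr1 v); rewrite !rmorphM !rmorph_nat => /(mulfI p0); exact: vinj.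
have G1 (y : A) (y1 : 1 + y + y ^+ 2 = 0) :
    72 * (fpolylog p R 2).[1 - pi y]
    = pi (4 * (1 - y ^+ p ^+ 2) * (l * b) - 9 * (1 - y ^+ p) * q' ^+ 2).
  have F1 := fpolylog1_Fermat_quotient pi p_prime p_gt3 pR y1 pq preg.
  have piy1 : 1 + pi y + pi y ^+ 2 = 0.
    by rewrite -rmorphXn -[1](rmorph1 pi) -!rmorphD y1 rmorph0.
  rewrite (fpolylog2_1Bcube_root p_prime pR p_gt3 piy1 F1 Pb).
  by rewrite rmorphB !rmorphM !rmorphB !rmorph_nat !rmorphXn rmorph1 rmorph_int.
(* [144] is the least common multiple of [16] and [36], and twice the factor [72] in [G1]. *)
have c72 : coprime 144 p.
  have -> : (144 = 2 ^ 4 * 3 ^ 2)%N by [].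
  by rewrite coprimeMl; apply/andP; split; apply: coprimeXl; apply: (coprime_lt p_prime); lia.
have dp : (2 < p.-1)%N by lia.
have vz : v z = - omega6 ^ e by rewrite rmorphN vw.
have vs : v s' = s by rewrite rmorph_int.
have vl : v l = L by rewrite rmorph_int.
have vu : v z ^+ p = - ((1 + s * L * sqrtm3) / 2).
  by rewrite -(rmorphXn v) zp rmorphN rmorphM rmorphD rmorph1 !rmorphM vs vl vr vh mul1r.
have L2 : L ^+ 2 - 1 = 0 by rewrite -vl -rmorphXn l2 rmorph1 subrr.
have sLr : s ^+ 2 * L ^+ 2 * (sqrtm3 * sqrtm3) + 3 = 0.
  have vs2 : s ^+ 2 = 1 by rewrite -vs -(rmorphXn v) s2 rmorph1.
  by rewrite vs2 mul1r; move/eqP: L2; rewrite subr_eq0 => /eqP ->; rewrite mul1r sqrtm3_sqr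
    addNr.
split.
  have [a va pa] := polylog_residue p_prime p_gt3 (1 - z) dp.
  apply: (@cong_mod_residue p p_prime 144 (144 * a)
    (2 * (4 * (1 - z ^+ p ^+ 2) * (l * b) - 9 * (1 - z ^+ p) * q' ^+ 2)) _ _ c72).
  - by rewrite rmorphM rmorph_nat va rmorphB rmorph1 -/v vz opprK.
  - rewrite rmorphM rmorphB !rmorphM !rmorphB !rmorphXn -/v vu rmorph1 !rmorph_nat vl vb vq.
    apply/eqP; rewrite -subr_eq0; apply/eqP.
    (* The two sides differ by a combination of the relations [L2] and [sLr]. *)
    transitivity ((- 4 * s * sqrtm3 * B) * (L ^+ 2 - 1)
      - 2 * L * B * (s ^+ 2 * L ^+ 2 * (sqrtm3 * sqrtm3) + 3)); first by field.
    by rewrite L2 sLr !mulr0 subr0.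
  - rewrite -/pi !rmorphM -/pi pa rmorphB rmorph1.
    have := G1 z z1; rewrite -/pi => G.
    rewrite -[X in _ = _ * X]/(pi _) -G !rmorph_nat mulrA; congr (_ * _); ring.
have [a va pa] := polylog_residue p_prime p_gt3 ((1 - z) * t) dp.
apply: (@cong_mod_residue p p_prime 144 (144 * a)
  (2 * (- 4 * z ^+ p * (l * b) - 9 * q' ^+ 2)) _ _ c72).
- by rewrite rmorphM rmorph_nat va rmorphM rmorphB rmorph1 -/v vz vt opprK mul1r.
- rewrite rmorphM rmorphB !rmorphM !rmorphXn -/v vu !rmorph_nat vl vb vq rmorphN rmorph_nat.
  apply/eqP; rewrite -subr_eq0; apply/eqP.
  transitivity ((4 * s * sqrtm3 * B) * (L ^+ 2 - 1)); first by field.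
  by rewrite L2 mulr0.
(* Apply [G1] at [z ^ 2], then invert: [1 - z ^ 2] and [(1 - z) * t] are mutually inverse, and
   [(1 - z ^ 2) ^ p] reduces to [1 - z ^ (2 p)]. *)
- have z21 : 1 + z ^+ 2 + (z ^+ 2) ^+ 2 = 0.
    by rewrite -exprM (cube_root_expr z1 (2 * 2)) /= addrAC.
  have G := G1 _ z21; rewrite (exprAC z 2 p) in G.
  have u1 : 1 + z ^+ p + z ^+ p ^+ 2 = 0 by apply: (prime_cube_root_sum p_prime p_gt3 z1).
  have y1 : pi (1 - z ^+ 2) * pi ((1 - z) * t) = 1.
    rewrite -rmorphM -(rmorph1 pi); congr (pi _).
    transitivity (3 * t + (z - 2) * (1 + z + z ^+ 2) * t); first by ring.
    by rewrite z1 mulr0 mul0r addr0.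
  have piu : pi (1 - z ^+ 2) ^+ p = pi (1 - z ^+ p ^+ 2).
    have [X EX _] := expr1B_prime pi p_prime p_gt3 pR (z ^+ 2).
    have pp0 : pi p%:R = 0 by rewrite rmorph_nat; exact: pR.
    by rewrite -rmorphXn EX rmorphB (rmorphM _ p%:R) pp0 mul0r subr0 (exprAC z 2 p).
  have I := fpolylog_inv p_prime pR p_gt3 y1 dp.
  rewrite sqrrN expr1n mul1r piu -pa in I.
  rewrite -[1 - pi _](_ : pi (1 - z ^+ 2) = _) in G; last by rewrite rmorphB rmorph1.
  rewrite I -/pi in G; move: (z ^+ p) G u1 => u G u1.
  pose D := 72 * ((1 - u ^+ 2) * a)
    - (4 * (1 - u ^+ 2 ^+ 2) * (l * b) - 9 * (1 - u ^+ 2) * q' ^+ 2).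
  have D0 : pi D = 0 by rewrite rmorphB rmorphM (rmorphM _ _ a) rmorph_nat G subrr.
  apply/eqP; rewrite -subr_eq0 -rmorphB; apply/eqP.
  apply: (@natr_lt_mul_eq0 p R p_prime pR 3); first by lia.
  rewrite -(rmorph_nat pi 3) -rmorphM.
  (* The factor [1 - u] turns the coefficient [1 - u ^ 2] of [a] into [3], modulo [1 + u + u ^ 2];
     the result is three times the desired difference. *)
  transitivity (pi (2 * (1 - u) * D - (1 + u + u ^+ 2) * (144 * (u - 2) * a
     - 8 * (u ^+ 3 - 2 * u ^+ 2 + u + 1) * (l * b) + 18 * (u - 2) * q' ^+ 2))).
    by congr (pi _); rewrite /D; ring.
  by rewrite u1 mul0r subr0 rmorphM D0 mulr0.
Qed.
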